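(* Let $c \in \mathbb{R}$ and let $f:\mathbb{R}\to\mathbb{R}$ admit a Taylor expansion around $c$, i.e. $f(z)=\sum_{k=0}^{\infty}\frac{f^{(k)}(c)}{k!}(z-c)^k$ for all $z \in \mathbb{R}$. For $\alpha\in(0,1)$ and $\beta\in\mathbb{R}$, let ${}_{c}F_{\alpha,\beta}:\mathbb{R}\to\mathbb{R}$ be the smoothing of $f$ defined by $$ {}_{c}F_{\alpha,\beta}(z) = f(c) + f'(c)(z-c) + \sum_{k=2}^{\infty} C_{k,\alpha,\beta}\, \frac{f^{(k)}(c)}{k!}(z-c)^{k}, $$ where $$ C_{k,\alpha,\beta} = \frac{\Gamma(2-\alpha)\Gamma(k)}{\Gamma(k+1-\alpha)} + \beta\,\frac{\Gamma(2-\alpha)\Gamma(k)}{\Gamma(k-\alpha)}. $$ Then, for any $x\neq c$, the steepest descent direction of ${}_{c}F_{\alpha,\beta}$ at $x$ is $$ ({}_{c}F_{\alpha,\beta})'(x) = \frac{{}_{c}^{C}D^{\alpha}_x f(x)}{{}_{c}^{C}D^{\alpha}_x I(x)} + \beta\,|x-c|\cdot \frac{{}_{c}^{C}D^{1+\alpha}_x f(x)}{{}_{c}^{C}D^{\alpha}_x I(x)}, $$ where $I:\mathbb{R}\to\mathbb{R}$ is the identity map $I(x)=x$.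
   Context: Caputo fractional derivatives. Let $\nu\in(n-1,n)$ with $n\in\mathbb{N}$, and let $c\in\mathbb{R}$. For $x>c$, ${}_{c}^{C}D_x^{\nu} g(x)$ denotes the left Caputo fractional derivative $$\frac{1}{\Gamma(n-\nu)}\int_c^x \frac{g^{(n)}(t)}{(x-t)^{\nu-n+1}}\,dt .$$ For $x<c$, the same symbol ${}_{c}^{C}D_x^{\nu} g(x)$ is understood as the right Caputo fractional derivative $$\frac{(-1)^n}{\Gamma(n-\nu)}\int_x^c \frac{g^{(n)}(t)}{(t-x)^{\nu-n+1}}\,dt .$$ Here $g^{(n)}$ is the $n$-th derivative and $\Gamma$ is the Gamma function. The order $1+\alpha$ with $\alpha\in(0,1)$ corresponds to $n=2$. Convention: ''the steepest descent direction'' of a differentiable function $F$ at $x$ refers to the derivative $F'(x)$ (which is subtracted in a descent step). *)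

(* Defs.v *)
From mathcomp Require Import all_boot all_order all_algebra.
From mathcomp Require Import all_classical all_reals all_analysis.

Set Implicit Arguments.
Unset Strict Implicit.
Unset Printing Implicit Defensive.

Import Order.TTheory GRing.Theory Num.Theory.
Import numFieldNormedType.Exports.

Local Open Scope ring_scope.
Local Open Scope classical_set_scope.

(* Euler's integral; it converges, and so defines Gamma, only for 0 < s. *)
Definition Gamma {R : realType} (s : R) : R :=
  \int[lebesgue_measure]_(t in `]0, +oo[) (t `^ (s - 1) * expR (- t)).

(* For 0 <= nu not an integer, the unique n with n - 1 < nu < n. *)
Definition caputo_ord {R : realType} (nu : R) : nat := (Num.truncn nu).+1.

(* Caputo derivative of order nu of g at x with base point c: left-sided if
   c < x, right-sided if x < c. The integrals are Lebesgue integrals, so the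
   value of the integrand at the singular end point t = x is immaterial. *)
Definition caputo {R : realType} (nu c : R) (g : R -> R) (x : R) : R :=
  let n := caputo_ord nu in
  if c < x then
    (Gamma (n%:R - nu))^-1 *
    \int[lebesgue_measure]_(t in `[c, x])
      (derive1n n g t / (x - t) `^ (nu - n%:R + 1))
  else
    (-1) ^+ n / Gamma (n%:R - nu) *
    \int[lebesgue_measure]_(t in `[x, c])
      (derive1n n g t / (t - x) `^ (nu - n%:R + 1)).

(* Smoothness of f is not a separate hypothesis: a function equal everywhere to
   a convergent power series is smooth, so the values derive1n k f c, which are
   arbitrary for a non-differentiable f, are here the actual derivatives. *)
Definition has_taylor_expansion {R : realType} (f : R -> R) (c : R) : Prop :=
  forall z : R,
    series (fun k : nat => derive1n k f c / k`!%:R * (z - c) ^+ k) @ \oo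
      --> f z.

Definition smoothing_coef {R : realType} (alpha beta : R) (k : nat) : R :=
  Gamma (2 - alpha) * Gamma k%:R / Gamma (k%:R + 1 - alpha) +
  beta * (Gamma (2 - alpha) * Gamma k%:R / Gamma (k%:R - alpha)).

(* When f has a Taylor expansion on the whole line, smoothing_coef grows at
   most polynomially in k, so the series converges at every z. *)
Definition smoothing {R : realType} (f : R -> R) (c alpha beta z : R) : R :=
  f c + derive1 f c * (z - c) +
  limn (fun n : nat => \sum_(2 <= k < n)
    smoothing_coef alpha beta k * (derive1n k f c / k`!%:R) * (z - c) ^+ k).

(* Main.v *)
(* Write d = x - c. With p(t) = (t - c) / d, which runs over ]0, 1[ when t is
   strictly between c and x, the left and right Caputo derivatives are both
     sgn(d)^n |d|^(-alpha) / Gamma(1 - alpha) * int f^(n)(t) (1 - p(t))^(-alpha) dt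
   for the orders alpha (n = 1) and 1 + alpha (n = 2). Since f = sum a_k (t - c)^k
   everywhere, f' and f'' may be expanded in powers of p and integrated
   termwise. Integrating the derivative of p^(k+1) (1 - p)^(1 - alpha) gives the
   moments int p^k (1 - p)^(-alpha) = rho_k int (1 - p)^(-alpha), where
   rho_k = Gamma(2 - alpha) Gamma(k + 1) / Gamma(k + 2 - alpha), and the common
   factor is precisely the one appearing in the derivative of the identity. The
   quotients are thus sum rho_k (k+1) a_(k+1) d^k and, up to the sign of d,
   sum rho_k (k+2) (k+1) a_(k+2) d^k; the theorem is then the termwise
   derivative of the smoothing, where C_k = rho_(k-1) + beta (k-1) rho_(k-2). *)
Require Import Defs.
From mathcomp Require Import all_boot all_order all_algebra.
From mathcomp Require Import all_classical all_reals all_analysis.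
From mathcomp Require Import measurable_realfun ring lra.

Set Implicit Arguments.
Unset Strict Implicit.
Unset Printing Implicit Defensive.

Import Order.TTheory GRing.Theory Num.Theory.
Import numFieldNormedType.Exports.

Local Open Scope ring_scope.
Local Open Scope classical_set_scope.

(** * The fundamental theorem of calculus on open intervals *)

Section FTC_exhaustion.
Context {R : realType}.
Notation mu := (@lebesgue_measure R).
Variables (f F : R -> R) (D : set R) (a b : nat -> R) (l : R).
Hypothesis ab : forall n, a n < b n.
Hypothesis nia : nonincreasing_seq a.
Hypothesis ndb : nondecreasing_seq b.
Hypothesis DE : D = \bigcup_n `[a n, b n].
Hypothesis dF : forall x, D x -> is_derive x 1 F (f x).
Hypothesis cf : forall x, D x -> {for x, continuous f}.
Hypothesis Fl : F (b n) - F (a n) @[n --> \oo] --> l.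

Let itvD n x : x \in `[a n, b n]%R -> D x.
Proof. by move=> xab; rewrite DE; exists n. Qed.

Let nd_itv : nondecreasing_seq (fun n => `[a n, b n]%classic).
Proof.
move=> m n mn; rewrite subsetEset => x /=; rewrite !in_itv/= => /andP[ax xb].
by rewrite (le_trans (nia mn) ax) (le_trans xb (ndb mn)).
Qed.

Let FTC_itv n :
  (\int[mu]_(x in `[a n, b n]) (f x)%:E = (F (b n) - F (a n))%:E)%E.
Proof.
have cF : {within `[a n, b n], continuous F}.
  apply: derivable_within_continuous => x /(@itvD n) Dx.
  by have := dF Dx => -[].
rewrite EFinB; apply: continuous_FTC2 => //.
- apply: continuous_in_subspaceT => x; rewrite inE => xab.
  by apply: cf; exact: itvD xab.
- split.
  + move=> x xab; have Dx : D x by apply: (@itvD n);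
      exact: subset_itv_oo_cc xab.
    by have := dF Dx => -[].
  + by have /(continuous_within_itvP _ (ab n))[] := cF.
  + by have /(continuous_within_itvP _ (ab n))[] := cF.
- move=> x xab; have Dx : D x by apply: (@itvD n); exact: subset_itv_oo_cc xab.
  by rewrite derive1E; have := dF Dx => -[].
Qed.

Let mD : measurable D.
Proof. by rewrite DE; apply: bigcupT_measurable => n;
  exact: measurable_itv. Qed.

Lemma measurable_exhaustion : measurable_fun D f.
Proof.
rewrite DE; apply/measurable_fun_bigcup => [n|n]; first exact: measurable_itv.
apply: subspace_continuous_measurable_fun; first exact: measurable_itv.
apply: continuous_in_subspaceT => x; rewrite inE => xab.
by apply: cf; exact: itvD xab.
Qed.

(** The usual theorem gives [F (b n) - F (a n)] on each compact interval, and monotone convergence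
    passes to the union. The finite value then yields integrability. *)
Lemma ge0_FTC_exhaustion : (forall x, D x -> 0 <= f x) ->
  (\int[mu]_(x in D) (f x)%:E = l%:E)%E.
Proof.
move=> f0.
have : (\int[mu]_(x in `[a n, b n]) (f x)%:E @[n --> \oo] -->
        \int[mu]_(x in \bigcup_n `[a n, b n]) (f x)%:E)%E.
  apply: ge0_nondecreasing_set_cvg_integral => //.
  - move=> n; apply/measurable_EFinP.
    apply: measurable_funS measurable_exhaustion => //.
    by move=> x; exact: itvD.
  - by move=> n x /(@itvD n) Dx; rewrite lee_fin f0.
rewrite -DE => /(cvg_lim _) <- //.
apply/cvg_lim => //; under eq_cvg do rewrite FTC_itv.
by apply: cvg_EFin => //; exact: nearW.
Qed.

Lemma ge0_integrable_FTC_exhaustion : (forall x, D x -> 0 <= f x) ->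
  mu.-integrable D (EFin \o f).
Proof.
move=> f0; apply/integrableP; split.
  by apply/measurable_EFinP; exact: measurable_exhaustion.
under eq_integral.
  move=> x /[!inE] Dx; rewrite gee0_abs ?lee_fin ?f0//.
  over.
by rewrite ge0_FTC_exhaustion// ltry.
Qed.

(** Handles [f] of variable sign: its restrictions to [[a n, b n]] are eventually constant in [n] at
    each point of [D] and dominated by the modulus of [f], so dominated convergence applies. *)
Lemma Rintegral_FTC_exhaustion : mu.-integrable D (EFin \o f) ->
  \int[mu]_(x in D) f x = l.
Proof.
move=> intf.
have /(cvg_lim _) limE : (\int[mu]_(x in D) ((f \_ `[a n, b n])
  x)%:E @[n --> \oo] -->
    \int[mu]_(x in D) (f x)%:E)%E.
  apply: (@dominated_cvg _ _ _ mu D mD (fun n x => ((f \_ `[a n, b n]) x)%:E)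
    (EFin \o f) (fun x => `|f x|%:E)) => //.
  - move=> n; apply/measurable_EFinP.
    apply: measurable_funTS; apply/(measurable_restrictT _ _).1 => //.
    apply: measurable_funS measurable_exhaustion => //.
    by move=> x; exact: itvD.
  - move=> x; rewrite DE => -[n _ xn].
    apply: cvg_near_cst; exists n => // m /= nm; congr (_%:E).
    rewrite patchE mem_set//.
    by have := nd_itv nm; rewrite subsetEset; apply.
  - exact: integrable_norm.
  - move=> n x Dx; rewrite lee_fin patchE.
    by case: ifPn => // _; rewrite normr0.
rewrite /Rintegral -limE//.
rewrite (@cvg_lim _ _ _ _ _ _ l%:E)//.
have intE n : (\int[mu]_(x in D) ((f \_ `[a n, b n]) x)%:E =
    (F (b n) - F (a n))%:E)%E.
  rewrite -(FTC_itv n) -[in RHS](setIidr (_ : `[a n, b n] `<=` D)); last first.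
    by move=> x; exact: itvD.
  by rewrite integral_mkcondr; apply: eq_integral => x _; rewrite restrict_EFin.
under eq_cvg do rewrite intE.
by apply: cvg_EFin => //; exact: nearW.
Qed.

End FTC_exhaustion.

(** * Bounded open intervals with one-sided limits at the ends *)

Section FTC_oo.
Context {R : realType}.
Notation mu := (@lebesgue_measure R).
Variables (f F : R -> R) (a b la lb : R).
Hypothesis ab : a < b.
Hypothesis dF : forall x, a < x < b -> is_derive x 1 F (f x).
Hypothesis cf : forall x, a < x < b -> {for x, continuous f}.
Hypothesis Fa : F x @[x --> a^'+] --> la.
Hypothesis Fb : F x @[x --> b^'-] --> lb.

(** Denominators start at 3 so that [2 * r n < b - a] already for [n = 0]. *)
Let r n : R := (b - a) / n.+3%:R.

Let r0 n : 0 < r n. Proof. by rewrite divr_gt0// subr_gt0. Qed.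

Let r_cvg0 : r n @[n --> \oo] --> 0.
Proof.
rewrite -[0](mulr0 (b - a)); apply: cvgM; first exact: cvg_cst.
have := @cvg_harmonic R; rewrite -(cvg_shiftn 2).
by apply: cvg_trans; apply: near_eq_cvg; near=> n; rewrite /harmonic/= addn2.
Unshelve. all: by end_near. Qed.

Let r_lt n : a + r n < b - r n.
Proof.
rewrite -subr_gt0 (_ : _ - _ = (b - a) * (1 - 2 / n.+3%:R));
  last by rewrite /r; ring.
rewrite mulr_gt0 ?subr_gt0// ltr_pdivrMr// mul1r ltr_nat.
by [].
Qed.

Let r_noninc : nonincreasing_seq r.
Proof.
move=> m n mn; rewrite /r ler_pM2l ?subr_gt0// lef_pV2 ?posrE// ler_nat.
by rewrite !ltnS.
Qed.

Let DE : `]a, b[%classic = \bigcup_n `[a + r n, b - r n].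
Proof.
apply/seteqP; split => x /=.
  rewrite in_itv/= => /andP[ax xb].
  have e0 : 0 < Order.min (x - a) (b - x) by rewrite lt_min !subr_gt0 ax.
  have /cvgrPdist_lt/(_ _ e0)[N _ /(_ N (leqnn N))] := r_cvg0.
  rewrite /= sub0r normrN gtr0_norm// lt_min => /andP[h1 h2].
  exists N => //=; rewrite in_itv/=; apply/andP; split; lra.
move=> [n _]; rewrite /= !in_itv/= => /andP[h1 h2].
by apply/andP; split; have := r0 n; lra.
Qed.

Let dF' x : `]a, b[%classic x -> is_derive x 1 F (f x).
Proof. by rewrite /= in_itv/=; exact: dF. Qed.

Let Fl : F (b - r n) - F (a + r n) @[n --> \oo] --> lb - la.
Proof.
apply: cvgB.
  apply: ((cvg_at_leftP F b lb).1 Fb); split; first by move=> n;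
    rewrite ltrBlDr ltrDl.
  by rewrite -[X in _ --> X](subr0 b); apply: cvgB => //; exact: cvg_cst.
apply: ((cvg_at_rightP F a la).1 Fa); split; first by move=> n; rewrite ltrDl.
by rewrite -[X in _ --> X](addr0 a); apply: cvgD => //; exact: cvg_cst.
Qed.

Lemma ge0_integrable_FTC_oo : (forall x, a < x < b -> 0 <= f x) ->
  mu.-integrable `]a, b[ (EFin \o f).
Proof.
move=> f0; apply: (@ge0_integrable_FTC_exhaustion R f F _ _ _ _ r_lt _ _ DE dF'
  _ Fl).
- by move=> m n /r_noninc; rewrite lerD2l.
- by move=> m n /r_noninc; rewrite lerD2l lerN2.
- by move=> x; rewrite /= in_itv/=; exact: cf.
- by move=> x; rewrite /= in_itv/=; exact: f0.
Qed.

Lemma Rintegral_FTC_oo : mu.-integrable `]a, b[ (EFin \o f) ->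
  \int[mu]_(x in `]a, b[) f x = lb - la.
Proof.
move=> intf; apply: (@Rintegral_FTC_exhaustion R f F _ _ _ _ r_lt _ _ DE dF' _
  Fl) => //.
- by move=> m n /r_noninc; rewrite lerD2l.
- by move=> m n /r_noninc; rewrite lerD2l lerN2.
Qed.

End FTC_oo.

(** * The half-line *)

Section FTC_0y.
Context {R : realType}.
Notation mu := (@lebesgue_measure R).
Variables (f F : R -> R) (l0 ly : R).
Hypothesis dF : forall x : R, 0 < x -> is_derive x 1 F (f x).
Hypothesis cf : forall x : R, 0 < x -> {for x, continuous f}.
Hypothesis F0 : F x @[x --> 0^'+] --> l0.
Hypothesis Fy : F x @[x --> +oo] --> ly.

Let a n : R := n.+2%:R^-1.
Let b n : R := n.+2%:R.

Let ab n : a n < b n.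
Proof. by rewrite (@lt_trans _ _ 1)// ?invf_lt1// ltr1n. Qed.

Let nia : nonincreasing_seq a.
Proof. by move=> m n mn; rewrite /a lef_pV2 ?posrE// ler_nat !ltnS. Qed.

Let ndb : nondecreasing_seq b.
Proof. by move=> m n mn; rewrite ler_nat !ltnS. Qed.

Let b_cvgy : b n @[n --> \oo] --> +oo.
Proof.
apply/cvgryPge => A; near=> n.
rewrite (@le_trans _ _ n%:R)//; last by rewrite ler_nat (leq_trans (leqnSn n)).
by near: n; exact: nbhs_infty_ger.
Unshelve. all: by end_near. Qed.

Let a_cvg0 : a n @[n --> \oo] --> 0.
Proof.
have := @cvg_harmonic R; rewrite -(cvg_shiftn 1).
by apply: cvg_trans; apply: near_eq_cvg; near=> n; rewrite /harmonic/= addn1.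
Unshelve. all: by end_near. Qed.

Let DE : `]0, +oo[%classic = \bigcup_n `[a n, b n].
Proof.
apply/seteqP; split => x /=.
  rewrite in_itv/= andbT => x0.
  have /cvgrPdist_lt/(_ _ x0)[N _ hN] := a_cvg0.
  have /cvgryPge/(_ x)[M _ hM] := b_cvgy.
  exists (maxn N M) => //=; rewrite in_itv/=; apply/andP; split.
    have /= := hN _ (leq_maxl N M).
    by rewrite sub0r normrN gtr0_norm ?invr_gt0// => /ltW.
  exact: hM _ (leq_maxr N M).
move=> [n _]; rewrite /= !in_itv/= => /andP[h1 h2].
by rewrite andbT (lt_le_trans _ h1)// invr_gt0.
Qed.

Let dF' (x : R) : `]0, +oo[%classic x -> is_derive x 1 F (f x).
Proof. by rewrite /= in_itv/= andbT; exact: dF. Qed.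

Let Fl : F (b n) - F (a n) @[n --> \oo] --> ly - l0.
Proof.
apply: cvgB; first exact: ((cvg_pinftyP F ly).1 Fy).
by apply: ((cvg_at_rightP F 0 l0).1 F0); split => // n; rewrite invr_gt0.
Qed.

Lemma ge0_integrable_FTC_0y : (forall x : R, 0 < x -> 0 <= f x) ->
  mu.-integrable `]0, +oo[ (EFin \o f).
Proof.
move=> f0; apply: (@ge0_integrable_FTC_exhaustion R f F _ _ _ _ ab nia ndb DE
  dF' _ Fl).
- by move=> x; rewrite /= in_itv/= andbT; exact: cf.
- by move=> x; rewrite /= in_itv/= andbT; exact: f0.
Qed.

Lemma Rintegral_FTC_0y : mu.-integrable `]0, +oo[ (EFin \o f) ->
  \int[mu]_(x in `]0, +oo[) f x = ly - l0.
Proof.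
move=> intf; apply: (@Rintegral_FTC_exhaustion R f F _ _ _ _ ab nia ndb DE dF'
  _ Fl) => //.
- by move=> x; rewrite /= in_itv/= andbT; exact: cf.
Qed.

End FTC_0y.

(** * The Gamma function *)

Section derive_lemmas.
Context {R : realType}.
Implicit Types (f u : R -> R) (x r : R).

Lemma is_derive1_continuous f x df : is_derive x 1 f df -> {for x,
  continuous f}.
Proof.
by move=> [fx _]; apply: differentiable_continuous; exact/derivable1_diffP.
Qed.

Lemma is_derive1_powR_comp u x du r : 0 < u x -> is_derive x 1 u du ->
  is_derive x 1 (fun t => u t `^ r) (r * u x `^ (r - 1) * du).
Proof.
move=> ux dux; exact: (@is_derive1_comp R (fun t => t `^ r)
  u x _ _ (is_derive1_powR r ux) dux).
Qed.

(** Positivity of [u] along [G] upgrades its convergence to 0 into convergence to [0^'+], where the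
    power function tends to 0. *)
Lemma cvg_powR_at_right0 T (G : set_system T) {FG : Filter G} (u : T -> R) r :
  0 < r -> (\forall t \near G, 0 < u t) -> u t @[t --> G] --> 0 ->
  u t `^ r @[t --> G] --> 0.
Proof.
move=> r0 u0 cu; apply: (@cvg_comp _ _ _ u (fun t => t `^ r) _ (0^'+));
  last exact: powR_cvg0.
by move=> A /= /cu; apply: filterS2 u0 => t ut; apply.
Qed.

End derive_lemmas.

(** * Integrating the derivative of u^s for u rising from 0 to 1 on the half-line *)

Section powR_subst.
Context {R : realType}.
Notation mu := (@lebesgue_measure R).
Variables (u du : R -> R) (s : R).
Hypothesis s0 : 0 < s.
Hypothesis u0 : forall x : R, 0 < x -> 0 < u x.
Hypothesis du0 : forall x : R, 0 < x -> 0 <= du x.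
Hypothesis dudu : forall x : R, 0 < x -> is_derive x 1 u (du x).
Hypothesis cdu : forall x : R, 0 < x -> {for x, continuous du}.
Hypothesis cu0 : u x @[x --> 0^'+] --> (0 : R).
Hypothesis cuy : u x @[x --> +oo] --> (1 : R).

Let f x := s * u x `^ (s - 1) * du x.
Let F x := u x `^ s.

Let f0 (x : R) : 0 < x -> 0 <= f x.
Proof. by move=> x0; rewrite mulr_ge0 ?du0// mulr_ge0 ?powR_ge0// ltW. Qed.

Let dF (x : R) : 0 < x -> is_derive x 1 F (f x).
Proof. by move=> x0; apply: is_derive1_powR_comp; [exact: u0|exact: dudu]. Qed.

Let cf (x : R) : 0 < x -> {for x, continuous f}.
Proof.
move=> x0; apply: cvgM; last exact: cdu.
apply: cvgM; first exact: cvg_cst.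
exact: is_derive1_continuous (is_derive1_powR_comp (s - 1) (u0 x0) (dudu x0)).
Qed.

Let F0 : F x @[x --> 0^'+] --> (0 : R).
Proof.
apply: cvg_powR_at_right0 => //.
by near=> x; apply: u0; near: x; exact: nbhs_right_gt.
Unshelve. all: by end_near. Qed.

Let Fy : F x @[x --> +oo] --> (1 : R).
Proof.
rewrite (_ : (1 : R) = 1 `^ s); last by rewrite powR1.
apply: (@continuous_cvg _ _ _ _ _ u (fun t : R => t `^ s)) => //.
exact: is_derive1_continuous (is_derive1_powR _ ltr01).
Qed.

(** A nonnegative function whose primitive [F] has finite limits at 0 and infinity. Two choices of
    [u] serve below, one to bound the Gamma integrand from above and one to bound it from below. *)
Lemma integrable_powR_subst : mu.-integrable `]0, +oo[ (EFin \o f).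
Proof. exact: (ge0_integrable_FTC_0y dF cf F0 Fy). Qed.

Lemma Rintegral_powR_subst : \int[mu]_(x in `]0, +oo[) f x = 1.
Proof.
by rewrite (Rintegral_FTC_0y dF cf F0 Fy integrable_powR_subst) subr0.
Qed.

End powR_subst.

Section Gamma.
Context {R : realType}.
Notation mu := (@lebesgue_measure R).
Implicit Types s t : R.

(** Raise [1 + t <= (1 + m) * (1 + t / m) <= (1 + m) * expR (t / m)] to the power [m]. This controls
    the decay of [expR (- t)] by powers of [1 + t]. *)
Lemma powR_le_expR m t : 0 < m -> 0 <= t ->
  (1 + t) `^ m <= (1 + m) `^ m * expR t.
Proof.
move=> m0 t0.
have h : 1 + t <= (1 + m) * expR (t / m).
  apply: (@le_trans _ _ ((1 + m) * (1 + t / m))).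
    rewrite mulrDl mul1r mulrDr mulr1 mulrCA divff ?gt_eqF// mulr1.
    have : 0 <= t / m by rewrite divr_ge0// ltW.
    lra.
  by rewrite ler_pM2l ?expR_ge1Dx//; lra.
rewrite -[X in expR X](divfK (lt0r_neq0 m0)) expRM -powRM ?expR_ge0//; last lra.
apply: ge0_ler_powR h; rewrite ?nnegrE; first exact: ltW; first lra.
by rewrite mulr_ge0 ?expR_ge0//; lra.
Qed.

Let is_derive_expRN t : is_derive t 1 (fun t => expR (- t)) (- expR (- t)).
Proof.
have := @is_derive1_comp R expR -%R t _ _ (is_derive_expR _) (is_deriveNid _ _).
by rewrite mulrN1.
Qed.

Let cvg_expRN0 : expR (- t) @[t --> 0^'+] --> (1 : R).
Proof.
apply: cvg_at_right_filter; rewrite -[X in _ --> X](@expR0 R)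
  -[in X in _ --> X](oppr0 R).
exact: is_derive1_continuous (is_derive_expRN 0).
Qed.

Let is_derive_powR_expRN s t : 0 < t ->
  is_derive t 1 (fun t => t `^ s * expR (- t))
    (s * (t `^ (s - 1) * expR (- t)) - t `^ s * expR (- t)).
Proof.
move=> t0.
have := @is_deriveM _ _ _ _ t 1 _ _ (is_derive1_powR s t0) (is_derive_expRN t).
move/is_derive_eq; apply.
by rewrite /GRing.scale/= mulrN addrC; congr (_ - _); rewrite mulrC mulrA.
Qed.

Let cts_powR_expRN s t : 0 < t ->
  {for t, continuous (fun t => t `^ s * expR (- t))}.
Proof. by move=> t0; exact: is_derive1_continuous (is_derive_powR_expRN s t0).
  Qed.

Let cvgV1D : (1 + t)^-1 @[t --> +oo] --> (0 : R).
Proof.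
apply/gtr0_cvgV0; first by near=> t; rewrite addr_gt0//; near: t;
  apply: nbhs_pinfty_gt; exact: num_real.
by apply/cvgryPge => A; near=> t; rewrite -lerBlDl; near: t;
  apply: nbhs_pinfty_ge; exact: num_real.
Unshelve. all: by end_near. Qed.

(* Dominated by a multiple of the derivative of (t / (1 + t))^s. *)
Lemma Gamma_integrand_integrable s : 0 < s ->
  mu.-integrable `]0, +oo[ (fun t => (t `^ (s - 1) * expR (- t))%:E).
Proof.
move=> s0.
pose u (t : R) := 1 - (1 + t)^-1; pose du (t : R) := (1 + t)^-1 * (1 + t)^-1.
have dudu (t : R) : 0 < t -> is_derive t 1 u (du t).
  move=> t0; have t1 : 1 + t != 0 by rewrite gt_eqF// addr_gt0.
  have d1 : is_derive t 1 (fun t : R => 1 + t) 1.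
    by have := is_deriveD (is_derive_cst (1 : R) t 1) (is_derive_id t 1);
      rewrite add0r.
  have := is_deriveB (is_derive_cst (1 : R) t 1) (is_deriveV t1 d1).
  by move/is_derive_eq; apply; rewrite /GRing.scale/= mulr1 sub0r opprK /du
    -expr2 exprVn.
have uE (t : R) : 0 < t -> u t = t / (1 + t).
  by move=> t0; rewrite /u; field; rewrite gt_eqF// addr_gt0.
have int : mu.-integrable `]0, +oo[ (EFin \o (fun x => s * u x `^ (s - 1)
  * du x)).
  apply: integrable_powR_subst => //.
  - by move=> x x0; rewrite uE// divr_gt0// addr_gt0.
  - by move=> x x0; rewrite mulr_ge0// invr_ge0 addr_ge0// ltW.
  - move=> x x0; have cV : {for x, continuous (fun t : R => (1 + t)^-1)}.
      apply: cvgV; first by rewrite gt_eqF// addr_gt0.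
      by apply: cvgD; [exact: cvg_cst|exact: cvg_id].
    exact: cvgM.
  - have : u x @[x --> (0 : R)] --> (1 - (1 + 0)^-1 : R).
      apply: cvgB; first exact: cvg_cst.
      apply: cvgV; first by rewrite addr0.
      by apply: cvgD; [exact: cvg_cst|exact: cvg_id].
    by rewrite addr0 invr1 subrr; exact: cvg_at_right_filter.
  - rewrite -[X in _ --> X](subr0 1); apply: cvgB; first exact: cvg_cst.
    exact: cvgV1D.
(* Here u^(s-1) u' equals t^(s-1) (1+t)^(-(s+1)), so the numerator is the constant of [powR_le_expR]
   at [m = s + 1]; dividing by [s] cancels the factor produced by differentiating u^s. *)
pose C := (1 + (s + 1)) `^ (s + 1) / s.
have {}int : mu.-integrable `]0, +oo[
    (EFin \o (fun x => C * (s * u x `^ (s - 1) * du x))).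
  by apply: eq_integrable (integrableZl _ C int) => //= x _; rewrite EFinM.
apply: le_integrable int => //.
  apply/measurable_EFinP; apply: open_continuous_measurable_fun;
    first exact: interval_open.
  by move=> x; rewrite inE/= in_itv/= andbT; exact: cts_powR_expRN.
move=> t; rewrite /= in_itv/= andbT => t0.
have t1 : 0 < 1 + t by rewrite addr_gt0.
have C0 : 0 <= C by rewrite divr_ge0 ?powR_ge0// ltW.
rewrite lee_fin ger0_norm; last by rewrite mulr_ge0 ?powR_ge0 ?expR_ge0.
rewrite ger0_norm; last first.
  by rewrite !mulr_ge0 ?powR_ge0 ?invr_ge0 ?(ltW s0) ?(ltW t1).
rewrite uE// powRM ?invr_ge0 ?(ltW t0) ?(ltW t1)//.
have -> : (1 + t)^-1 `^ (s - 1) = (1 + t) `^ (- (s - 1)).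
  by rewrite -powR_inv1 ?(ltW t1)// -powRrM mulN1r.
have -> : du t = (1 + t) `^ (- 2)
  by rewrite /du -expr2 exprVn -powR_invn ?(ltW t1).
have -> : C * (s * (t `^ (s - 1) * (1 + t) `^ (- (s - 1))) * (1 + t) `^ (- 2)) =
    t `^ (s - 1) * ((1 + (s + 1)) `^ (s + 1) / (1 + t) `^ (s + 1)).
  rewrite -(powRN _ (s + 1)) (_ : - (s + 1) = - (s - 1) + - 2); last ring.
  rewrite (@powRD _ (1 + t) (- (s - 1))); last by rewrite (gt_eqF t1) implybT.
  by rewrite /C; field; rewrite gt_eqF.
rewrite ler_wpM2l ?powR_ge0// expRN ler_pdivlMr ?powR_gt0//.
rewrite mulrC ler_pdivrMr ?expR_gt0//; apply: powR_le_expR; last exact: ltW.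
by rewrite addr_gt0.
Qed.

Lemma Gamma1 : Gamma 1 = 1 :> R.
Proof.
rewrite /Gamma.
have intg := Gamma_integrand_integrable ltr01.
have dF (t : R) : 0 < t ->
    is_derive t 1 (fun t => - expR (- t)) (t `^ (1 - 1) * expR (- t)).
  move=> t0; rewrite subrr powRr0 mul1r -[X in is_derive _ _ _ X]opprK.
  exact: is_deriveN.
rewrite (@Rintegral_FTC_0y R _ _ (- 1) 0 dF _ _ _ intg).
- by rewrite sub0r opprK.
- by move=> t t0; exact: cts_powR_expRN.
- exact: cvgN.
- by rewrite -oppr0; apply: cvgN; exact: cvgr_expR.
Qed.

(** Integration by parts in one stroke: the difference of the two integrands is the derivative of
    t^s e^(-t), which vanishes at 0 and at infinity. *)
Lemma GammaS s : 0 < s -> Gamma (s + 1) = s * Gamma s.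
Proof.
move=> s0; have s1 : 0 < s + 1 by rewrite addr_gt0.
have i0 := Gamma_integrand_integrable s0.
have i1 := Gamma_integrand_integrable s1.
rewrite addrK in i1.
have is0 : mu.-integrable `]0, +oo[
    (EFin \o (fun t => s * (t `^ (s - 1) * expR (- t)))).
  by apply: eq_integrable (integrableZl _ s i0) => //= x _; rewrite EFinM.
rewrite /Gamma addrK -RintegralZl//.
apply/eqP; rewrite eq_sym -subr_eq0 -RintegralB//.
rewrite (@Rintegral_FTC_0y R _ _ 0 0 (is_derive_powR_expRN s)) ?subrr//.
- move=> t t0; apply: cvgB; last exact: cts_powR_expRN.
  by apply: cvgM; [exact: cvg_cst|exact: cts_powR_expRN].
- by rewrite -[X in _ --> X](mul0r 1); apply: cvgM => //; exact: powR_cvg0.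
(* At infinity, t^s (1+t) <= (1+t)^(s+1) <= C e^t, so t^s e^(-t) is squeezed below C / (1+t). *)
- pose C : R := (1 + (s + 1)) `^ (s + 1).
  apply: (@squeeze_cvgr _ _ _ R (fun=> 0) (fun t => C * (1 + t)^-1)).
  + near=> t.
    have t0 : 0 < t by near: t; apply: nbhs_pinfty_gt; exact: num_real.
    have t1 : 0 < 1 + t by rewrite addr_gt0.
    rewrite mulr_ge0 ?powR_ge0 ?expR_ge0//=.
    rewrite expRN ler_pdivrMr ?expR_gt0// mulrAC ler_pdivlMr//.
    apply: le_trans (powR_le_expR s1 (ltW t0)).
    rewrite powRD; last by rewrite (gt_eqF t1) implybT.
    rewrite powRr1 ?(ltW t1)// ler_pM2r//.
    by apply: ge0_ler_powR; rewrite ?nnegrE ?ltW// ltrDr.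
  + exact: cvg_cst.
  + by rewrite -[X in _ --> X](mulr0 C); apply: cvgM; [exact: cvg_cst|].
- apply: eq_integrable (integrableB _ is0 i1) => //.
Unshelve. all: by end_near. Qed.

(* For 1 <= s the integrand of s Gamma(s) dominates the derivative of
   (1 - e^(-t))^s, whose integral is 1. *)
Lemma Gamma_gt0 s : 0 < s -> 0 < Gamma s.
Proof.
(* The recurrence moves [s] to [s + 1]; for [1 <= s] the map t -> t^(s-1) is nondecreasing, so 1 -
   e^(-t) <= t can be raised to that power. *)
wlog s1 : s / 1 <= s => [wl s0|s0].
  rewrite -(pmulr_rgt0 _ s0) -GammaS//; apply: wl; last exact: addr_gt0.
  by rewrite lerDr ltW.
pose u (t : R) := 1 - expR (- t); pose du (t : R) := expR (- t).
have u0 (t : R) : 0 < t -> 0 < u t by move=> t0;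
  rewrite subr_gt0 expR_lt1 oppr_lt0.
have du0 (t : R) : 0 < t -> 0 <= du t by rewrite expR_ge0.
have dudu (t : R) : 0 < t -> is_derive t 1 u (du t).
  move=> t0; have := is_deriveB (is_derive_cst (1 : R) t 1) (is_derive_expRN t).
  by rewrite sub0r opprK.
have cdu (t : R) : 0 < t -> {for t, continuous du}.
  by move=> _; exact: is_derive1_continuous (is_derive_expRN t).
have cu0 : u x @[x --> 0^'+] --> (0 : R).
  by rewrite -[X in _ --> X](subrr 1); apply: cvgB => //; exact: cvg_cst.
have cuy : u x @[x --> +oo] --> (1 : R).
  rewrite -[X in _ --> X](subr0 1); apply: cvgB; first exact: cvg_cst.
  exact: cvgr_expR.
have int1 := integrable_powR_subst s0 u0 du0 dudu cdu cu0 cuy.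
have int2 := Gamma_integrand_integrable s0.
rewrite -(pmulr_rgt0 _ s0) /Gamma -RintegralZl//.
apply: (lt_le_trans ltr01).
rewrite -[leLHS](Rintegral_powR_subst s0 u0 du0 dudu cdu cu0 cuy).
apply: le_Rintegral => //.
  by apply: eq_integrable (integrableZl _ s int2) => //= x _; rewrite EFinM.
move=> t; rewrite /= in_itv/= andbT => t0.
rewrite -mulrA ler_pM2l// ler_wpM2r ?expR_ge0//.
apply: ge0_ler_powR; rewrite ?nnegrE ?subr_ge0//.
- by rewrite expR_le1 oppr_le0 ltW.
- exact: ltW.
- by rewrite lerBlDr -lerBlDl; have := expR_ge1Dx (- t); lra.
Qed.

End Gamma.

(** * Entire power series *)

Section entire_series.
Context {R : realType}.
Implicit Types (a b : R ^nat) (c d x z : R).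

Definition entire a := forall z, cvgn (pseries a z).

Lemma is_cvg_series_shift (u : R ^nat) j :
  cvgn (series u) -> cvgn (series (fun k => u (k + j)%N)).
Proof.
move=> cu; have -> : series (fun k => u (k + j)%N) =
    (fun n => series u (n + j)%N - series u j).
  apply/funext => n; rewrite series_addn addrAC subrr add0r seriesEnat/=.
  by rewrite -{2}(add0n j) big_addn addnK.
apply: is_cvgB; last exact: is_cvg_cst.
by apply/cvg_ex; exists (limn (series u)); rewrite cvg_shiftn.
Qed.

(** Convergence at [|z| + 1], which lies farther out than [z], allows the coefficients to be
    replaced by their moduli. *)
Lemma entire_norm a z : entire a -> cvgn (pseries (fun k => `|a k|) z).
Proof.
move=> ea; apply: (is_cvg_pseries_inside_norm (ea (`|z| + 1))).
by rewrite [ltRHS]ger0_norm ?addr_ge0// ltrDl.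
Qed.

(** The comparison test behind the convergence claims below: a factor M^k only rescales the point of
    evaluation, and the index shift only drops finitely many terms. *)
Lemma entire_dominated a b j (C M : R) : 0 <= C -> 0 <= M ->
  (forall k, `|b k| <= C * M ^+ k * `|a (k + j)%N|) -> entire a -> entire b.
Proof.
move=> C0 M0 ba ea z; apply: normed_cvg.
(* Adding 1 ensures [1 <= W], so that W^(k+j) dominates (M |z|)^k in spite of the shift by [j]. *)
pose W := M * `|z| + 1.
have Mz : 0 <= M * `|z| by rewrite mulr_ge0.
have W1 : 1 <= W by rewrite /W lerDr.
have W0 : 0 <= W by rewrite (le_trans _ W1).
pose v k := C * (`|a (k + j)%N| * W ^+ (k + j)).
apply: (@series_le_cvg _ _ v) => [k|k|k|].
- exact: normr_ge0.
- by apply: mulr_ge0 => //; apply: mulr_ge0 => //; exact: exprn_ge0.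
- rewrite /= normrM normrX.
  apply: (@le_trans _ _ (C * M ^+ k * `|a (k + j)%N| * `|z| ^+ k)).
    by rewrite ler_wpM2r// exprn_ge0.
  rewrite -!mulrA ler_wpM2l// mulrCA ler_wpM2l// -exprMn exprD.
  rewrite -[leLHS]mulr1 ler_pM ?exprn_ge0 ?exprn_ege1//.
  by apply: lerXn2r; rewrite ?nnegrE// /W lerDl.
- have -> : v = C *: (fun k => `|a (k + j)%N| * W ^+ (k + j)) by apply/funext.
  apply: is_cvg_seriesZ.
  by apply: (@is_cvg_series_shift (fun k => `|a k| * W ^+ k));
    exact: entire_norm.
Qed.

Lemma entire_diffs a : entire a -> entire (pseries_diffs a).
Proof.
(* The weight k + 1 of the differentiated series is at most 2^k. *)
apply: (@entire_dominated _ _ 1%N 1 2) => // k.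
rewrite /pseries_diffs normrM ger0_norm// mul1r addn1 ler_wpM2r//.
by rewrite -natrX ler_nat ltn_expl.
Qed.

Lemma entire_is_derive a c x : entire a ->
  is_derive x 1 (fun t => limn (pseries a (t - c)))
    (limn (pseries (pseries_diffs a) (x - c))).
Proof.
move=> ea; have ea' := entire_diffs ea; have ea'' := entire_diffs ea'.
have d1 : is_derive x 1 (fun t : R => t - c) 1.
  by have := is_deriveB (is_derive_id x 1) (is_derive_cst c x 1); rewrite subr0.
(* Termwise differentiation uses convergence of the series and of its first two formal derivatives
   at a point of larger modulus. *)
have d2 := pseries_snd_diffs (ea (`|x - c| + 1)) (ea' _) (ea'' _).
rewrite -[X in is_derive _ _ _ X]mulr1.
apply: (@is_derive1_comp R (fun t => limn (pseries a t)) _ x _ _ _ d1).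
by apply: d2; rewrite [ltRHS]ger0_norm ?addr_ge0// ltrDl.
Qed.

Lemma entire_derive1 a c : entire a ->
  derive1 (fun t => limn (pseries a (t - c))) =
    fun t => limn (pseries (pseries_diffs a) (t - c)).
Proof.
move=> ea; apply/funext => t; rewrite derive1E.
by have [_ ->] := entire_is_derive c t ea.
Qed.

End entire_series.

(** * Termwise integration of a power series against an integrable weight *)

Section termwise.
Context d (T : measurableType d) {R : realType}.
Variables (mu : {measure set T -> \bar R}) (D : set T) (mD : measurable D).
Variables (A : R ^nat) (p w : T -> R).
Hypothesis mp : measurable_fun D p.
Hypothesis p1 : forall t, D t -> `|p t| <= 1.
Hypothesis intw : mu.-integrable D (EFin \o w).
Hypothesis cA : cvgn (series (fun k => `|A k|)).

Lemma integrable_expn_mul k : mu.-integrable D (EFin \o (fun t =>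
  p t ^+ k * w t)).
Proof.
apply: le_integrable intw => //.
  apply/measurable_EFinP; apply: measurable_funM; first exact: measurable_funX.
  by apply/measurable_EFinP; exact: measurable_int intw.
move=> t Dt; rewrite lee_fin normrM normrX ler_piMl//.
by rewrite exprn_ile1// p1.
Qed.

Lemma cvg_pseries_bounded t : D t -> cvgn (pseries A (p t)).
Proof.
move=> Dt; apply: normed_cvg; apply: series_le_cvg cA => [k|k|k];
  first exact: normr_ge0.
  exact: normr_ge0.
by rewrite /= normrM normrX ler_piMr// exprn_ile1// p1.
Qed.

Lemma integrable_sum_expn_mul n :
  mu.-integrable D (EFin \o (fun t => pseries A (p t) n * w t)) /\
  \int[mu]_(t in D) (pseries A (p t) n * w t) =
  series (fun k => A k * \int[mu]_(t in D) (p t ^+ k * w t)) n.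
Proof.
elim: n => [|n [IH1 IH2]].
  have E0 t : pseries A (p t) 0 * w t = 0.
    by rewrite /pseries seriesEnat/= big_geq// mul0r.
  split; first by apply: eq_integrable (integrable0 mu D) => //= t _;
    rewrite E0.
  rewrite seriesEnat/= big_geq//; under eq_Rintegral do rewrite E0.
  by rewrite Rintegral_cst// mul0r.
have ES t : pseries A (p t) n.+1 * w t =
    pseries A (p t) n * w t + A n * (p t ^+ n * w t).
  by rewrite /pseries seriesSr/= mulrDl mulrA.
have intn : mu.-integrable D (EFin \o (fun t => A n * (p t ^+ n * w t))).
  by apply: eq_integrable (integrableZl mD (A n) (integrable_expn_mul n)) => //.
split.
  by apply: eq_integrable (integrableD mD IH1 intn) => //= t _;
    rewrite ES EFinD.
under eq_Rintegral do rewrite ES.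
rewrite RintegralD// IH2 RintegralZl//.
  by rewrite seriesSr.
exact: integrable_expn_mul.
Qed.

Lemma measurable_lim_pseries_mul :
  measurable_fun D (fun t => limn (pseries A (p t)) * w t).
Proof.
apply: measurable_funM; last first.
  by apply/measurable_EFinP; exact: measurable_int intw.
apply: (@measurable_fun_cvg _ _ _ _ (fun n t => pseries A (p t) n)).
  move=> n; apply: measurable_sum => k.
  by apply: measurable_funM => //; exact: measurable_funX.
by move=> t Dt; exact: cvg_pseries_bounded.
Qed.

Lemma cvg_pseries_mul t : D t ->
  (pseries A (p t) n * w t)%:E @[n --> \oo] --> (limn (pseries A (p t))
    * w t)%:E.
Proof.
move=> Dt; apply: cvg_EFin; first exact: nearW.
by apply: cvgM; [exact: cvg_pseries_bounded|exact: cvg_cst].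
Qed.

Lemma norm_pseries_mul_le n t : D t ->
  `|pseries A (p t) n * w t| <= limn (series (fun k => `|A k|)) * `|w t|.
Proof.
move=> Dt; rewrite normrM ler_wpM2r//.
rewrite /pseries [in leLHS]seriesEnat/=; apply: le_trans (ler_norm_sum _ _ _) _.
apply: (@le_trans _ _ (series (fun k => `|A k|) n)).
  rewrite seriesEnat/=; apply: ler_sum => k _.
  by rewrite normrM normrX ler_piMr// exprn_ile1// p1.
apply: nondecreasing_cvgn_le => //.
by apply: nondecreasing_series => k _ _; exact: normr_ge0.
Qed.

(** Since [p] has modulus at most 1, every partial sum is bounded by the sum of the moduli of the
    [A k]. A multiple of the modulus of [w] therefore dominates, even for a weight with a
    singularity. *)
Lemma termwise_Rintegral :
  mu.-integrable D (EFin \o (fun t => limn (pseries A (p t)) * w t)) /\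
  series (fun k => A k * \int[mu]_(t in D) (p t ^+ k * w t)) @ \oo -->
  \int[mu]_(t in D) (limn (pseries A (p t)) * w t).
Proof.
pose S := limn (series (fun k => `|A k|)).
have intS : mu.-integrable D (EFin \o (fun t => S * `|w t|)).
  by apply: eq_integrable (integrableZl mD S (integrable_norm intw)) => //.
have [|||||intl _ cvgI] := @dominated_convergence _ _ _ mu D mD
    (fun n t => (pseries A (p t) n * w t)%:E)
    (EFin \o (fun t => limn (pseries A (p t)) * w t))
    (EFin \o (fun t => S * `|w t|)).
- by move=> n; have [/measurable_int] := integrable_sum_expn_mul n.
- by apply/measurable_EFinP; exact: measurable_lim_pseries_mul.
- by apply: aeW => t Dt; exact: cvg_pseries_mul.
- exact: intS.
- by apply: aeW => t n Dt; rewrite lee_fin; exact: norm_pseries_mul_le.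
split=> //; move: cvgI; rewrite -[X in _ --> X -> _]fineK;
  last exact: integrable_fin_num.
move=> /fine_cvg; apply: cvg_trans; apply: near_eq_cvg; apply: nearW => n.
by rewrite -(integrable_sum_expn_mul n).2.
Qed.

End termwise.

(** * The fundamental theorem between two points in either order *)

Section FTC_between.
Context {R : realType}.
Notation mu := (@lebesgue_measure R).
Variables (f F : R -> R) (a b la lb : R).
Hypothesis ab : b != a.
Let D : set R := `]Order.min a b, Order.max a b[.
Hypothesis dF : forall x, D x -> is_derive x 1 F (f x).
Hypothesis cf : forall x, D x -> {for x, continuous f}.
Hypothesis Fa : F x @[x --> within D (nbhs a)] --> la.
Hypothesis Fb : F x @[x --> within D (nbhs b)] --> lb.

(** Points just to the right of the lower end lie in [D], so a limit along [D] is a one-sided limit.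
    End points can thus be named [a] and [b] before knowing which is larger. *)
Let at_right_within (u v : R) : u < v -> D = `]u, v[%classic ->
  u^'+ `=>` within D (nbhs u).
Proof.
move=> uv DE A; rewrite /at_right /within/= DE => hA.
apply: filterS2 hA (lt_nbhsl uv) => t At tv ut; apply: At.
by rewrite /= in_itv/= ut.
Qed.

Let at_left_within (u v : R) : u < v -> D = `]u, v[%classic ->
  v^'- `=>` within D (nbhs v).
Proof.
move=> uv DE A; rewrite /at_left /within/= DE => hA.
apply: filterS2 hA (lt_nbhsr uv) => t At ut tv; apply: At.
by rewrite /= in_itv/= ut.
Qed.

Lemma ge0_integrable_FTC_between : (forall x, D x -> 0 <= f x) ->
  mu.-integrable D (EFin \o f).
Proof.
move: dF cf Fa Fb at_right_within at_left_within; rewrite /D.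
have [abl|bal] := ltP a b.
- move=> dF' cf' Fa' Fb' r l f0.
  have dF'' (x : R) : a < x < b -> is_derive x 1 F (f x) by move=> xab;
    apply: dF'; rewrite /= in_itv.
  apply: (@ge0_integrable_FTC_oo _ f F a b la lb abl dF'').
  + by move=> x xab; apply: cf'; rewrite /= in_itv.
  + by move=> A /Fa'; exact: (r _ _ abl erefl).
  + by move=> A /Fb'; exact: (l _ _ abl erefl).
  + by move=> x xab; apply: f0; rewrite /= in_itv.
- have {}bal : b < a by rewrite lt_neqAle ab.
  move=> dF' cf' Fa' Fb' r l f0.
  have dF'' (x : R) : b < x < a -> is_derive x 1 F (f x) by move=> xab;
    apply: dF'; rewrite /= in_itv.
  apply: (@ge0_integrable_FTC_oo _ f F b a lb la bal dF'').
  + by move=> x xab; apply: cf'; rewrite /= in_itv.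
  + by move=> A /Fb'; exact: (r _ _ bal erefl).
  + by move=> A /Fa'; exact: (l _ _ bal erefl).
  + by move=> x xab; apply: f0; rewrite /= in_itv.
Qed.

(** The integral over a set carries no orientation; the sign of [b - a] restores it. *)
Lemma Rintegral_FTC_between : mu.-integrable D (EFin \o f) ->
  \int[mu]_(x in D) f x = Num.sg (b - a) * (lb - la).
Proof.
move: dF cf Fa Fb at_right_within at_left_within; rewrite /D.
have [abl|bal] := ltP a b.
- move=> dF' cf' Fa' Fb' r l intf.
  have dF'' (x : R) : a < x < b -> is_derive x 1 F (f x) by move=> xab;
    apply: dF'; rewrite /= in_itv.
  rewrite gtr0_sg ?subr_gt0// mul1r.
  apply: (@Rintegral_FTC_oo _ f F a b la lb abl dF'') => //.
  + by move=> A /Fa'; exact: (r _ _ abl erefl).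
  + by move=> A /Fb'; exact: (l _ _ abl erefl).
- have {}bal : b < a by rewrite lt_neqAle ab.
  move=> dF' cf' Fa' Fb' r l intf.
  have dF'' (x : R) : b < x < a -> is_derive x 1 F (f x) by move=> xab;
    apply: dF'; rewrite /= in_itv.
  rewrite ltr0_sg ?subr_lt0// mulN1r opprB.
  apply: (@Rintegral_FTC_oo _ f F b a lb la bal dF'') => //.
  + by move=> A /Fb'; exact: (r _ _ bal erefl).
  + by move=> A /Fa'; exact: (l _ _ bal erefl).
Qed.

End FTC_between.

(** * The kernel of the Caputo derivative *)

Section beta_ratio.
Context {R : realType}.
Variable alpha : R.
Hypothesis alpha0 : 0 < alpha.
Hypothesis alpha1 : alpha < 1.

(* The ratio B(k + 1, 1 - alpha) / B(1, 1 - alpha) of values of the beta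
   function. *)
Definition beta_ratio k : R :=
  Gamma (2 - alpha) * Gamma k.+1%:R / Gamma (k.+2%:R - alpha).

Lemma beta_ratio0 : beta_ratio 0 = 1.
Proof.
rewrite /beta_ratio Gamma1 mulr1 divff// gt_eqF// Gamma_gt0// subr_gt0.
by rewrite (lt_trans alpha1)// ltr1n.
Qed.

Lemma beta_ratioS k :
  (k.+2%:R - alpha) * beta_ratio k.+1 = k.+1%:R * beta_ratio k.
Proof.
have [a0 a1] := (alpha0, alpha1); have k0 : 0 <= k%:R :> R by [].
have kE : k.+2%:R = k%:R + 2 :> R by rewrite -addn2 natrD.
have h : 0 < k.+2%:R - alpha by rewrite kE; lra.
rewrite /beta_ratio -[k.+3]addn1 -[in Gamma k.+2%:R]addn1 !natrD.
rewrite (_ : k.+2%:R + 1 - alpha = k.+2%:R - alpha + 1); last ring.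
rewrite !GammaS// ; field.
by apply/andP; split; rewrite gt_eqF ?Gamma_gt0//; lra.
Qed.

Lemma beta_ratio_ge0 k : 0 <= beta_ratio k.
Proof.
have [a0 a1] := (alpha0, alpha1); have k0 : 0 <= k%:R :> R by [].
rewrite /beta_ratio divr_ge0 ?mulr_ge0// ltW// Gamma_gt0//; first lra.
by rewrite -addn2 natrD; lra.
Qed.

(** The sequence starts at 1, and by the recurrence its successive quotients (k+1) / (k+2-alpha) are
    below 1. *)
Lemma beta_ratio_le1 k : beta_ratio k <= 1.
Proof.
elim: k => [|k]; first by rewrite beta_ratio0.
apply: le_trans.
have [a0 a1] := (alpha0, alpha1); have k0 : 0 <= k%:R :> R by [].
have h : 0 < k.+2%:R - alpha by rewrite -addn2 natrD; lra.
rewrite -(ler_pM2l h) beta_ratioS ler_wpM2r ?beta_ratio_ge0//.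
by rewrite -[k.+2]addn1 -[k.+1]addn1 !natrD; lra.
Qed.

Lemma beta_ratio_mul_entire (A : R ^nat) :
  entire A -> entire (fun k => beta_ratio k * A k).
Proof.
apply: (@entire_dominated _ A _ 0 1 1) => // k.
rewrite expr1n !mul1r addn0 normrM ler_piMl// ger0_norm ?beta_ratio_ge0//.
exact: beta_ratio_le1.
Qed.

(** The denominator of the second summand is one index behind that of the first; extracting a factor
    k - 1 from Gamma(k) realigns it as a [beta_ratio]. *)
Lemma smoothing_coef_beta_ratio beta m : smoothing_coef alpha beta m.+2 =
  beta_ratio m.+1 + beta * (m.+1%:R * beta_ratio m).
Proof.
rewrite /smoothing_coef /beta_ratio.
rewrite -[in m.+2%:R + 1](natrD _ m.+2 1) addn1; congr (_ + _ * _).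
rewrite -[in Gamma m.+2%:R]addn1 natrD GammaS//.
by rewrite mulrCA -!mulrA.
Qed.

End beta_ratio.

(** * Moments of the Abel kernel *)

Section abel_kernel.
Context {R : realType}.
Notation mu := (@lebesgue_measure R).
Variables (alpha c x : R).
Hypothesis alpha0 : 0 < alpha.
Hypothesis alpha1 : alpha < 1.
Hypothesis xc : x != c.

(** Written without assuming an order of [c] and [x], so that left and right derivatives share one
    computation. *)
Definition between : set R := `]Order.min c x, Order.max c x[.
Definition ratio_from t := (t - c) / (x - c).
Definition ratio_to t := (x - t) / (x - c).

Let d0 : x - c != 0. Proof. by rewrite subr_eq0. Qed.

Lemma ratio_toE t : ratio_to t = 1 - ratio_from t.
Proof. by rewrite /ratio_to /ratio_from; field. Qed.

Lemma ratio_to_gt0 t : between t -> 0 < ratio_to t.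
Proof.
rewrite /between /ratio_to /= in_itv/=; case: (ltgtP c x) xc =>
  [h _ /andP[h1 h2]|h _ /andP[h1 h2]|//].
  by rewrite divr_gt0 ?subr_gt0.
by rewrite -divrNN divr_gt0// oppr_gt0 subr_lt0.
Qed.

Lemma ratio_from_gt0 t : between t -> 0 < ratio_from t.
Proof.
rewrite /between /ratio_from /= in_itv/=; case: (ltgtP c x) xc =>
  [h _ /andP[h1 h2]|h _ /andP[h1 h2]|//].
  by rewrite divr_gt0 ?subr_gt0.
by rewrite -divrNN divr_gt0// oppr_gt0 subr_lt0.
Qed.

Lemma norm_ratio_from_le1 t : between t -> `|ratio_from t| <= 1.
Proof.
move=> Dt; rewrite ger0_norm ?ltW ?ratio_from_gt0//.
by have := ratio_to_gt0 Dt; rewrite ratio_toE; lra.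
Qed.

Let is_derive_from (t : R) : is_derive t 1 ratio_from (x - c)^-1.
Proof.
have h := is_deriveB (is_derive_id t 1) (is_derive_cst c t 1).
have := is_deriveM h (is_derive_cst (x - c)^-1 t 1).
by move/is_derive_eq; apply; rewrite scaler0 add0r subr0 /GRing.scale/= mulr1.
Qed.

Let is_derive_to (t : R) : is_derive t 1 ratio_to (- (x - c)^-1).
Proof.
have -> : ratio_to = (fun t => 1 - ratio_from t) by apply/funext => s;
  exact: ratio_toE.
have := is_deriveB (is_derive_cst (1 : R) t 1) (is_derive_from t).
by rewrite sub0r.
Qed.

Lemma continuous_ratio_from t : {for t, continuous ratio_from}.
Proof. exact: is_derive1_continuous (is_derive_from t). Qed.

(** The Abel kernel |x-t|^(-alpha), normalised to take the value 1 at [c]. *)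
Let w t := ratio_to t `^ (- alpha).

Let cvg_to_x : ratio_to t @[t --> within between (nbhs x)] --> (0 : R).
Proof.
have e : ratio_to x = 0 by rewrite /ratio_to subrr mul0r.
by rewrite -e; apply: cvg_within_filter; exact: is_derive1_continuous
  (is_derive_to x).
Qed.

Let cvg_to_c : ratio_to t @[t --> within between (nbhs c)] --> (1 : R).
Proof.
have e : ratio_to c = 1 by rewrite /ratio_to divff//.
by rewrite -e; apply: cvg_within_filter; exact: is_derive1_continuous
  (is_derive_to c).
Qed.

Let cvg_from_x : ratio_from t @[t --> within between (nbhs x)] --> (1 : R).
Proof.
have e : ratio_from x = 1 by rewrite /ratio_from divff//.
by rewrite -e; apply: cvg_within_filter; exact: @continuous_ratio_from x.
Qed.

Let cvg_from_c : ratio_from t @[t --> within between (nbhs c)] --> (0 : R).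
Proof.
have e : ratio_from c = 0 by rewrite /ratio_from subrr mul0r.
by rewrite -e; apply: cvg_within_filter; exact: @continuous_ratio_from c.
Qed.

Let cvg_to_powR_x :
  ratio_to t `^ (1 - alpha) @[t --> within between (nbhs x)] --> (0 : R).
Proof.
apply: cvg_powR_at_right0 cvg_to_x; first by rewrite subr_gt0.
by rewrite /prop_near1 /= /within/=; apply: nearW => t; exact: ratio_to_gt0.
Qed.

Let cvg_to_powR_c :
  ratio_to t `^ (1 - alpha) @[t --> within between (nbhs c)] --> (1 : R).
Proof.
have c1 : {for (1 : R), continuous (fun t : R => t `^ (1 - alpha))}.
  exact: is_derive1_continuous (is_derive1_powR _ ltr01).
have := continuous_cvg _ c1 cvg_to_c.
by rewrite /= powR1; apply.
Qed.

Let is_derive_to_powR (t r : R) : between t -> is_derive t 1 (fun t =>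
  ratio_to t `^ r)
  (r * ratio_to t `^ (r - 1) * - (x - c)^-1).
Proof.
by move=> Dt; exact: is_derive1_powR_comp (ratio_to_gt0 Dt) (is_derive_to t).
Qed.

Let cts_w t : between t -> {for t, continuous w}.
Proof.
by move=> Dt; exact: is_derive1_continuous (is_derive_to_powR (- alpha) Dt).
Qed.

(** Because [1 - alpha] is positive, this primitive keeps a finite limit at [x], where the kernel
    blows up. *)
Let dF0 (t : R) : between t -> is_derive t 1
  (fun t => - (x - c) / (1 - alpha) * ratio_to t `^ (1 - alpha)) (w t).
Proof.
move=> Dt; have := is_deriveM (is_derive_cst (- (x - c) / (1 - alpha)) t 1)
  (is_derive_to_powR (1 - alpha) Dt).
move/is_derive_eq; apply.
rewrite scaler0 addr0 /GRing.scale/= /w (_ : 1 - alpha - 1 = - alpha);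
  last ring.
by field; rewrite d0 subr_eq0 eq_sym lt_eqF.
Qed.

Let cvgF0x : - (x - c) / (1 - alpha) * ratio_to t `^ (1 - alpha)
  @[t --> within between (nbhs x)] --> (0 : R).
Proof.
rewrite -[X in _ --> X](mulr0 (- (x - c) / (1 - alpha))).
by apply: cvgM; [exact: cvg_cst|exact: cvg_to_powR_x].
Qed.

Let cvgF0c : - (x - c) / (1 - alpha) * ratio_to t `^ (1 - alpha)
  @[t --> within between (nbhs c)] --> (- (x - c) / (1 - alpha)).
Proof.
rewrite -[X in _ --> X]mulr1.
by apply: cvgM; [exact: cvg_cst|exact: cvg_to_powR_c].
Qed.

Lemma integrable_abel_kernel : mu.-integrable between (EFin \o w).
Proof.
apply: (@ge0_integrable_FTC_between _ _ _ _ _ _ _ xc dF0 _ cvgF0c cvgF0x).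
  exact: cts_w.
by move=> t _; exact: powR_ge0.
Qed.

Lemma measurable_between : measurable between.
Proof. exact: measurable_itv. Qed.

Lemma measurable_ratio_from D : measurable_fun D ratio_from.
Proof.
apply: measurable_funTS; apply: continuous_measurable_fun => t.
exact: continuous_ratio_from.
Qed.

(** The exact mass is |x-c| / (1-alpha); its positivity allows it to be cancelled from the Caputo
    quotients. *)
Lemma abel_kernel_gt0 : 0 < \int[mu]_(t in between) w t.
Proof.
rewrite (@Rintegral_FTC_between _ _ _ _ _ _ _ xc dF0 _ cvgF0c cvgF0x
  integrable_abel_kernel).
  rewrite sub0r mulNr opprK mulrA -normrEsg divr_gt0 ?subr_gt0//.
  by rewrite normr_gt0.
exact: cts_w.
Qed.

Lemma integrable_ratio_from_abel k :
  mu.-integrable between (EFin \o (fun t => ratio_from t ^+ k * w t)).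
Proof.
apply: integrable_expn_mul.
- exact: measurable_between.
- exact: measurable_ratio_from.
- exact: norm_ratio_from_le1.
- exact: integrable_abel_kernel.
Qed.

(** The derivative of p^(k+1) (1-p)^(1-alpha), with (1-p)^(1-alpha) split as (1-p) [w] so that only
    two consecutive moment integrands appear. *)
Let g k t := (x - c)^-1 * (k.+1%:R * (ratio_from t ^+ k * w t) -
  (k.+2%:R - alpha) * (ratio_from t ^+ k.+1 * w t)).

Let dF k (t : R) : between t -> is_derive t 1
  (fun t => ratio_from t ^+ k.+1 * ratio_to t `^ (1 - alpha)) (g k t).
Proof.
move=> Dt; have := is_deriveM (is_deriveX k.+1 (is_derive_from t))
  (is_derive_to_powR (1 - alpha) Dt).
have -> : (ratio_from ^+ k.+1 * (fun t0 => ratio_to t0 `^ (1 - alpha)) =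
  (fun t => ratio_from t ^+ k.+1 * ratio_to t `^ (1 - alpha))).
  by apply/funext => s; rewrite /= fctE exprfctE.
move/is_derive_eq; apply.
rewrite /GRing.scale/= /g /w exprfctE (_ : 1 - alpha - 1 = - alpha); last ring.
have -> : ratio_to t `^ (1 - alpha) = (1 - ratio_from t)
  * ratio_to t `^ (- alpha).
  rewrite powRD; last by rewrite (gt_eqF (ratio_to_gt0 Dt)) implybT.
  by rewrite powRr1 ?ratio_toE// -ratio_toE ltW// ratio_to_gt0.
rewrite -[k.+2]addn1 natrD exprS.
ring.
Qed.

(** The function differentiated in [dF] vanishes at both ends, so [g k] has integral zero. *)
Lemma Rintegral_ratio_fromS k :
  (k.+2%:R - alpha) * \int[mu]_(t in between) (ratio_from t ^+ k.+1 * w t) =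
  k.+1%:R * \int[mu]_(t in between) (ratio_from t ^+ k * w t).
Proof.
have i1 := integrable_ratio_from_abel k.
have i2 := integrable_ratio_from_abel k.+1.
have i3 : mu.-integrable between
    (EFin \o (fun t => k.+1%:R * (ratio_from t ^+ k * w t))).
  by apply: eq_integrable (integrableZl _ k.+1%:R i1) => //;
    exact: measurable_between.
have i4 : mu.-integrable between
    (EFin \o (fun t => (k.+2%:R - alpha) * (ratio_from t ^+ k.+1 * w t))).
  by apply: eq_integrable (integrableZl _ (k.+2%:R - alpha) i2) => //;
    exact: measurable_between.
have i5 : mu.-integrable between (EFin \o (fun t =>
    k.+1%:R * (ratio_from t ^+ k * w t) -
    (k.+2%:R - alpha) * (ratio_from t ^+ k.+1 * w t))).
  by apply: eq_integrable (integrableB _ i3 i4) => //;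
    exact: measurable_between.
have ig : mu.-integrable between (EFin \o g k).
  by apply: eq_integrable (integrableZl _ (x - c)^-1 i5) => //;
    exact: measurable_between.
have Fx : ratio_from t ^+ k.+1 * ratio_to t `^ (1 - alpha)
    @[t --> within between (nbhs x)] --> (0 : R).
  have h : ratio_from t ^+ k.+1 @[t --> within between (nbhs x)] --> (1 : R)
    ^+ k.+1.
    apply: (@continuous_cvg _ _ _ _ _ ratio_from (fun t : R => t ^+ k.+1)) =>
      //.
    exact: exprn_continuous.
  by rewrite -[X in _ --> X](mulr0 ((1 : R) ^+ k.+1)); exact: cvgM.
have Fc : ratio_from t ^+ k.+1 * ratio_to t `^ (1 - alpha)
    @[t --> within between (nbhs c)] --> (0 : R).
  have h : ratio_from t ^+ k.+1 @[t --> within between (nbhs c)] --> (0 : R)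
    ^+ k.+1.
    apply: (@continuous_cvg _ _ _ _ _ ratio_from (fun t : R => t ^+ k.+1)) =>
      //.
    exact: exprn_continuous.
  rewrite (_ : (0 : R) = 0 ^+ k.+1 * 1); last by rewrite expr0n mul0r.
  exact: cvgM.
have cw t : between t -> {for t, continuous w} := @cts_w t.
have cp t j : {for t, continuous (fun t => ratio_from t ^+ j)}.
  apply: (@continuous_comp _ _ _ ratio_from (fun t : R => t ^+ j)).
    exact: continuous_ratio_from.
  exact: exprn_continuous.
have cg t : between t -> {for t, continuous (g k)}.
  move=> Dt; apply: cvgM; first exact: cvg_cst.
  have cpw j : {for t, continuous (fun t => ratio_from t ^+ j * w t)}.
    by apply: cvgM; [exact: cp|exact: cw].
  by apply: cvgB; (apply: cvgM; [exact: cvg_cst|exact: cpw]).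
have := @Rintegral_FTC_between _ _ _ _ _ _ _ xc (@dF k) cg Fc Fx ig.
rewrite subrr mulr0 RintegralZl; [|exact: measurable_between|exact: i5].
rewrite RintegralB; [|exact: measurable_between|exact: i3|exact: i4].
rewrite RintegralZl; [|exact: measurable_between|exact: i1].
rewrite RintegralZl; [|exact: measurable_between|exact: i2].
move=> /eqP; rewrite mulf_eq0 invr_eq0 (negbTE d0)/= subr_eq0.
by move=> /eqP ->.
Qed.

(** Both sides agree at [k = 0] and obey the same first-order recurrence, by [Rintegral_ratio_fromS]
    and [beta_ratioS]. *)
Lemma Rintegral_ratio_from k :
  \int[mu]_(t in between) (ratio_from t ^+ k * w t) =
  beta_ratio alpha k * \int[mu]_(t in between) w t.
Proof.
elim: k => [|k IH].
  rewrite beta_ratio0// mul1r; apply: eq_Rintegral => t _.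
  by rewrite expr0 mul1r.
have [a0 a1] := (alpha0, alpha1); have k0 : 0 <= k%:R :> R by [].
have h : k.+2%:R - alpha != 0 by rewrite gt_eqF// -addn2 natrD; lra.
apply: (mulfI h); rewrite Rintegral_ratio_fromS IH mulrA.
by rewrite -(beta_ratioS alpha0 alpha1) -mulrA.
Qed.

End abel_kernel.

(** * Caputo derivatives as integrals against the Abel kernel *)

Section caputo.
Context {R : realType}.
Notation mu := (@lebesgue_measure R).
Variables (alpha c x : R).
Hypothesis alpha0 : 0 < alpha.
Hypothesis alpha1 : alpha < 1.
Hypothesis xc : x != c.

Let D := between c x.
Let w t := ratio_to c x t `^ (- alpha).

Lemma caputo_ord_lt1 : caputo_ord alpha = 1%N.
Proof.
by rewrite /caputo_ord (@truncn_def _ _ 0)// (ltW alpha0).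
Qed.

Lemma caputo_ord_1D : caputo_ord (1 + alpha) = 2%N.
Proof.
rewrite /caputo_ord (@truncn_def _ _ 1)// lerDl (ltW alpha0)/=.
by rewrite -[2%:R]/(1 + 1) ltrD2l.
Qed.

(** Both sides of [c] are treated at once: the power of the sign reproduces (-1)^n for the right
    derivative, and |x-t|^(-alpha) factors as |x-c|^(-alpha) times [w]. The relation between [nu],
    [n] and [alpha] gives the orders alpha and 1 + alpha the same kernel. *)
Lemma caputo_abel nu (g : R -> R)
  n : caputo_ord nu = n -> nu - n%:R + 1 = alpha ->
  mu.-integrable D (EFin \o (fun t => derive1n n g t * w t)) ->
  caputo nu c g x = Num.sg (x - c) ^+ n / Gamma (1 - alpha) *
    `|x - c| `^ (- alpha) * \int[mu]_(t in D) (derive1n n g t * w t).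
Proof.
move=> nuE alphaE inth.
have nE : n%:R - nu = 1 - alpha by rewrite -alphaE; ring.
rewrite -mulrA -RintegralZl//; last exact: measurable_between.
have xc0 : 0 < `|x - c| by rewrite normr_gt0 subr_eq0.
have wE t : D t -> `|x - c| `^ (- alpha) * (derive1n n g t * w t) =
    derive1n n g t / `|x - t| `^ alpha.
  move=> Dt; have q0 := ratio_to_gt0 xc Dt.
  rewrite mulrCA /w -powRM ?ltW//.
  rewrite powRN; congr (_ / _ `^ _).
  by rewrite -[ratio_to c x t]gtr0_norm// -normrM /ratio_to mulrC divfK//
    subr_eq0.
have intw : mu.-integrable D
    (EFin \o (fun t => `|x - c| `^ (- alpha) * (derive1n n g t * w t))).
  apply: eq_integrable (integrableZl _ (`|x - c| `^ (- alpha)) inth) => //;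
    exact: measurable_between.
rewrite /caputo nuE nE alphaE.
move: xc wE intw; rewrite /D /between neq_lt => /orP[h|h].
- rewrite ltNge (ltW h)/= ltr0_sg ?subr_lt0// (min_r (ltW h)) (max_l (ltW h)).
  move=> wE intw; congr (_ * _).
  have E : {in `]x, c[%classic, (fun t => `|x - c| `^ (- alpha)
    * (derive1n n g t * w t))
      =1 (fun t => derive1n n g t / (t - x) `^ alpha)}.
    move=> t; rewrite inE => Dt; rewrite wE// distrC gtr0_norm// subr_gt0.
    by move: Dt; rewrite /= in_itv/= => /andP[].
  transitivity (\int[mu]_(t in `]x, c[%classic) (derive1n n g t / (t - x)
    `^ alpha)); last first.
    by apply/esym; apply: eq_Rintegral.
  (* Closed and open intervals differ by two points, a null set; measurability on the open one comes
     from [intw]. *)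
  rewrite /Rintegral integral_itv_bndoo//.
  apply: eq_measurable_fun (measurable_int mu intw) => t Dt /=.
  by rewrite E.
- rewrite h gtr0_sg ?subr_gt0// (min_l (ltW h)) (max_r (ltW h)) expr1n mul1r.
  move=> wE intw; congr (_ * _).
  have E : {in `]c, x[%classic, (fun t => `|x - c| `^ (- alpha)
    * (derive1n n g t * w t))
      =1 (fun t => derive1n n g t / (x - t) `^ alpha)}.
    move=> t; rewrite inE => Dt; rewrite wE// gtr0_norm// subr_gt0.
    by move: Dt; rewrite /= in_itv/= => /andP[].
  transitivity (\int[mu]_(t in `]c, x[%classic) (derive1n n g t / (x - t)
    `^ alpha)); last first.
    by apply/esym; apply: eq_Rintegral.
  rewrite /Rintegral integral_itv_bndoo//.
  apply: eq_measurable_fun (measurable_int mu intw) => t Dt /=.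
  by rewrite E.
Qed.

Lemma caputo_entire nu (g : R -> R) n (A : R ^nat) :
  caputo_ord nu = n -> nu - n%:R + 1 = alpha -> entire A ->
  derive1n n g = (fun t => limn (pseries A (t - c))) ->
  caputo nu c g x = Num.sg (x - c) ^+ n / Gamma (1 - alpha) *
    `|x - c| `^ (- alpha) * (\int[mu]_(t in D) w t *
    limn (pseries (fun k => beta_ratio alpha k * A k) (x - c))).
Proof.
move=> nuE alphaE eA gE.
(* Rescaling by [x - c] turns a series in [t - c] into one in [ratio_from c x t], of modulus at most
   1; the [B k] are absolutely summable because [A] is entire. *)
pose B k := A k * (x - c) ^+ k.
have pE t : pseries A (t - c) = pseries B (ratio_from c x t).
  rewrite /pseries; congr series; apply/funext => k /=.
  by rewrite /B /ratio_from -mulrA -exprMn mulrCA divff ?mulr1// subr_eq0.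
have hE : (fun t => derive1n n g t * w t) =
    (fun t => limn (pseries B (ratio_from c x t)) * w t).
  by apply/funext => t; rewrite gE pE.
have cB : cvgn (series (fun k => `|B k|)).
  rewrite (_ : (fun k => `|B k|) = (fun k => `|A k| * `|x - c| ^+ k)).
    exact: entire_norm.
  by apply/funext => k; rewrite /B normrM normrX.
have [|||inth cvgh] := @termwise_Rintegral _ _ R mu D (measurable_between c x)
    B (ratio_from c x) w _ _ _ cB.
- exact: measurable_ratio_from.
- exact: norm_ratio_from_le1.
- exact: integrable_abel_kernel.
rewrite (caputo_abel nuE alphaE) ?hE//; congr (_ * _).
rewrite -(cvg_lim _ cvgh)//.
have er := beta_ratio_mul_entire alpha0 alpha1 eA.
rewrite -[RHS](lim_seriesZ _ (er _)); congr (limn (series _)).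
apply/funext => k; rewrite (Rintegral_ratio_from alpha0 alpha1 xc) /B.
rewrite -[RHS]/(_ * (_ * _ * _)).
ring.
Qed.

(** The integrand reduces to the kernel, leaving the factor shared with [caputo_entire] up to the
    power of the sign. *)
Lemma caputo_id : caputo alpha c id x =
  Num.sg (x - c) / Gamma (1 - alpha) * `|x - c| `^ (- alpha)
    * \int[mu]_(t in D) w t.
Proof.
have hE : (fun t => derive1n 1 id t * w t) = w.
  by apply/funext => t; rewrite derive1n1 derive1E derive_id mul1r.
rewrite (@caputo_abel alpha id 1) ?hE ?expr1//.
- exact: caputo_ord_lt1.
- by ring.
- exact: integrable_abel_kernel.
Qed.

End caputo.

(** * The smoothing as an entire power series *)

Section smoothing_series.
Context {R : realType}.
Implicit Types (a : R ^nat) (f : R -> R) (alpha beta c x z : R).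

Definition taylor_coef f c k : R := derive1n k f c / k`!%:R.

Lemma taylor_entire f c : has_taylor_expansion f c -> entire (taylor_coef f c).
Proof.
move=> hf z; apply/cvg_ex; exists (f (z + c)).
by have := hf (z + c); rewrite addrK.
Qed.

Lemma taylorE f c : has_taylor_expansion f c ->
  f = (fun t => limn (pseries (taylor_coef f c) (t - c))).
Proof. by move=> hf; apply/funext => t; apply/esym/cvg_lim => //;
  exact: hf. Qed.

(** Entireness is carried through the induction because each differentiation uses it for the current
    coefficients. *)
Lemma taylor_derive1n f c n : has_taylor_expansion f c ->
  entire (iter n (@pseries_diffs R) (taylor_coef f c)) /\
  derive1n n f =
    (fun t => limn (pseries (iter n (@pseries_diffs R) (taylor_coef f c))
      (t - c))).
Proof.
move=> hf; elim: n => [|n [en IH]].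
  by split; [exact: taylor_entire|exact: taylorE].
by rewrite derive1nS IH; split; [exact: entire_diffs|exact: entire_derive1].
Qed.

(** Extends C_k a_k to k = 0 and 1. At k = 1 the factor [m%:R] is zero, which neutralises the
    truncated [m.-1], and [beta_ratio alpha 0] is 1, so the linear term is unweighted. *)
Definition smoothing_series alpha beta a k : R :=
  if k is m.+1 then (beta_ratio alpha m + beta * (m%:R * beta_ratio alpha
    m.-1)) * a m.+1
  else a 0%N.

Lemma smoothing_series_entire alpha beta a : 0 < alpha -> alpha < 1 ->
  entire a -> entire (smoothing_series alpha beta a).
Proof.
(* As the ratios are at most 1, |C_(m+1)| <= 1 + |beta| m, which is below (1 + |beta|) 2^(m+1). *)
move=> alpha0 alpha1; apply: (@entire_dominated _ _ _ 0 (1 + `|beta|) 2).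
- by rewrite addr_ge0.
- by [].
- move=> k; rewrite addn0.
  have b0 : 0 <= `|beta| by [].
  case: k => [|m] /=.
    by rewrite expr0 mulr1 ler_peMl// lerDl.
  rewrite normrM ler_wpM2r// mulrDl mul1r.
  apply: le_trans (ler_normD _ _) _; rewrite (normrM beta) (normrM m%:R).
  rewrite !(ger0_norm (beta_ratio_ge0 alpha0 alpha1 _)).
  apply: lerD.
    by apply: le_trans (beta_ratio_le1 alpha0 alpha1 m) _;
      rewrite exprn_ege1// ler1n.
  rewrite ler_wpM2l// ger0_norm//.
  apply: (@le_trans _ _ m%:R).
    by rewrite ler_piMr// beta_ratio_le1.
  by rewrite -natrX ler_nat (leq_trans (ltnW (ltn_expl m (ltnSn 1))))//
    leq_pexp2l.
Qed.

Lemma smoothingE f c alpha beta : 0 < alpha -> alpha < 1 ->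
  has_taylor_expansion f c ->
  smoothing f c alpha beta =
  (fun z => limn (pseries (smoothing_series alpha beta (taylor_coef f c))
    (z - c))).
Proof.
move=> alpha0 alpha1 hf; apply/funext => z.
set b := smoothing_series _ _ _.
have cb : pseries b (z - c) @ \oo --> limn (pseries b (z - c)).
  exact: smoothing_series_entire (taylor_entire hf) _.
have b0 : b 0%N = f c by rewrite /b /= /taylor_coef fact0 divr1.
have b1 : b 1%N = derive1 f c.
  by rewrite /b /= mul0r mulr0 addr0 beta_ratio0// mul1r /taylor_coef factS
    fact0 divr1.
rewrite /smoothing.
rewrite (_ : limn _ = limn (pseries b (z - c)) - (f c + derive1 f c * (z - c))).
  by rewrite addrC subrK.
apply/cvg_lim => //.
have : pseries b (z - c) n - (f c + derive1 f c * (z - c)) @[n --> \oo] -->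
    limn (pseries b (z - c)) - (f c + derive1 f c * (z - c)).
  by apply: cvgB => //; exact: cvg_cst.
(* From [n = 2] on, the partial sums of the full series contain the constant and linear terms, whose
   removal leaves the sum starting at 2. *)
apply: cvg_trans; apply: near_eq_cvg; exists 2%N => // n /= n2.
rewrite /pseries seriesEnat /= (@big_cat_nat _ _ _ 2%N)//=.
rewrite big_nat_recl// big_nat1 expr0 expr1 mulr1 b0 b1.
rewrite [LHS](_ : _ = \sum_(2 <= k < n) b k * (z - c) ^+ k); last by ring.
apply: eq_big_nat => -[|[|m]]// _.
by rewrite smoothing_coef_beta_ratio.
Qed.

(** The beta part of the k-th differentiated term is beta k (k+1) rho_(k-1) a_(k+1) d^k: it vanishes
    at k = 0 and is otherwise beta d times term k - 1 of the series built on second derivatives. *)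
Lemma smoothing_series_diffs alpha beta a d : 0 < alpha -> alpha < 1 ->
  entire a ->
  limn (pseries (pseries_diffs (smoothing_series alpha beta a)) d) =
  limn (pseries (fun k => beta_ratio alpha k * pseries_diffs a k) d) +
  beta * d *
    limn (pseries (fun k => beta_ratio alpha k * pseries_diffs (pseries_diffs
      a) k) d).
Proof.
move=> alpha0 alpha1 ea.
have ea' := entire_diffs ea.
have e1 := beta_ratio_mul_entire alpha0 alpha1 ea'.
have e2 := beta_ratio_mul_entire alpha0 alpha1 (entire_diffs ea').
pose u k := pseries_diffs (smoothing_series alpha beta a) k * d ^+ k.
pose u1 k := beta_ratio alpha k * pseries_diffs a k * d ^+ k.
pose u2 k := beta_ratio alpha k * pseries_diffs (pseries_diffs a) k * d ^+ k.
have u0E : u 0%N = u1 0%N by rewrite /u /u1 /pseries_diffs/=; ring.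
have uSE k : u k.+1 = u1 k.+1 + beta * d * u2 k.
  by rewrite /u /u1 /u2 /pseries_diffs/= exprS; ring.
(* The index shift pairs [n.+1] terms of [u] and [u1] with only [n] terms of [u2]. *)
have E n : series u n.+1 = series u1 n.+1 + beta * d * series u2 n.
  elim: n => [|n IH].
    rewrite (seriesSr u 0) (seriesSr u1 0) u0E !seriesEnat/= !big_geq//.
    by rewrite mulr0 addr0.
  by rewrite (seriesSr u n.+1) IH (seriesSr u1 n.+1) (seriesSr u2 n) uSE; ring.
have cu : series u n.+1 @[n --> \oo] -->
    limn (series u1) + beta * d * limn (series u2).
  under eq_cvg do rewrite E.
  apply: cvgD; first by rewrite (cvg_shiftS (series u1)); exact: e1.
  by apply: cvgM; [exact: cvg_cst|exact: e2].
by apply/cvg_lim => //; rewrite -(cvg_shiftS (series u)).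
Qed.

End smoothing_series.

(** * The derivative of the smoothing in terms of Caputo quotients *)

Theorem theorem2p3 (R : realType) (c : R) (f : R -> R)
    (hf : has_taylor_expansion f c)
    (alpha beta : R) (halpha0 : 0 < alpha) (halpha1 : alpha < 1)
    (x : R) (hx : x != c) :
  derivable (smoothing f c alpha beta) x 1 /\
  derive1 (smoothing f c alpha beta) x =
    caputo alpha c f x / caputo alpha c id x +
    beta * `|x - c| * (caputo (1 + alpha) c f x / caputo alpha c id x).
Proof.
set a := taylor_coef f c.
have ea : entire a := taylor_entire hf.
have [e1 d1] := taylor_derive1n 1 hf.
have [e2 d2] := taylor_derive1n 2 hf.
have eb := @smoothing_series_entire _ alpha beta a halpha0 halpha1 ea.
have [dF F'E] := entire_is_derive c x eb.
rewrite (@smoothingE _ f c alpha beta halpha0 halpha1 hf); split;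
  first exact: dF.
rewrite derive1E F'E smoothing_series_diffs//.
rewrite (caputo_id halpha0 halpha1 hx).
rewrite (caputo_entire halpha0 halpha1 hx (caputo_ord_lt1 halpha0 halpha1)
  _ e1 d1); last by ring.
rewrite (caputo_entire halpha0 halpha1 hx (caputo_ord_1D halpha0 halpha1)
  _ e2 d2); last by ring.
(* The four factors of [caputo alpha c id x] are nonzero, so they cancel from both quotients. *)
have I0 := lt0r_neq0 (abel_kernel_gt0 halpha1 hx).
have G0 : Gamma (1 - alpha) != 0 by rewrite gt_eqF// Gamma_gt0// subr_gt0.
have h0 : `|x - c| `^ (- alpha) != 0.
  by rewrite gt_eqF// powR_gt0// normr_gt0 subr_eq0.
have s0 : Num.sg (x - c) != 0 by rewrite sgr_eq0 subr_eq0.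
(* The second quotient has the squared sign over the sign; the one left over turns the modulus of
   [x - c] into [x - c] itself. *)
rewrite (_ : beta * (x - c) = beta * `|x - c| * Num.sg (x - c)); last first.
  by rewrite -mulrA [`|_| * _]mulrC -numEsg.
by rewrite expr1; field; rewrite s0 G0 h0 I0.
Qed.
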